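(* Let $n\ge 1$ be an integer and let $p_1,\dots,p_n\in[0,1]$. Let $d(z,\bar\nu_n(\cdot),\bar\pi_n(\cdot))$ be the minimal distance in probability (defined in the context) between the partial sum process of independent Bernoulli random variables with success probabilities $p_1,\dots,p_n$ and the partial sum process of independent Poisson random variables with means $p_1,\dots,p_n$. Then for all integers $z\ge 0$, $$d(z,\bar\nu_n(\cdot),\bar\pi_n(\cdot))\ \ge\ \frac{1}{\sqrt{2\pi}}\exp\{-(z+3)\log(z+2)+z\}\sum_{k=1}^n B_k\,p_k^{z+2},$$ where $$B_k:=\exp\Bigl\{-\sum_{i=1}^k p_i\Bigr\}\prod_{j=1}^{k-1}p_j,\qquad k=1,\dots,n,$$ and $\prod_{j=1}^{0}p_j=1$ by definition. (In the factor $1/\sqrt{2\pi}$, $\pi$ is the usual constant $3.14159\ldots$) Moreover, $$d(0,\bar\nu_n(\cdot),\bar\pi_n(\cdot))\ \ge\ 1-\exp\Bigl\{-\frac12\sum_{i\le n}p_i^2(1-p_i)\Bigr\}.$$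
   Context: Here $\log$ is the natural logarithm. For $p_1,\dots,p_n$ given, $\nu_1,\dots,\nu_n$ denote independent Bernoulli random variables with $\mathbf P(\nu_i=1)=p_i=1-\mathbf P(\nu_i=0)$, and $\pi_1,\dots,\pi_n$ denote independent Poisson random variables with means $\mathbf E\pi_i=p_i$ (a Poisson variable with mean $0$ is identically $0$). The partial sum processes are $\bar\nu_n(k)=\sum_{i\le k}\nu_i$ and $\bar\pi_n(k)=\sum_{i\le k}\pi_i$, $k\le n$. For $z\ge 0$ the minimal distance is $$d(z,\bar\nu_n(\cdot),\bar\pi_n(\cdot))=\inf\ \mathbf P\Bigl(\max_{k\le n}\Bigl|\sum_{i=1}^k(\nu_i-\pi_i)\Bigr|>z\Bigr),$$ where the infimum is over all couplings, i.e. over all pairs of families $\{\nu_i\}_{i\le n}$ and $\{\pi_i\}_{i\le n}$ defined on a common probability space such that $\nu_1,\dots,\nu_n$ are mutually independent with $\nu_i$ Bernoulli with success probability $p_i$ for each $i\le n$, and $\pi_1,\dots,\pi_n$ are mutually independent with $\pi_i$ Poisson with mean $p_i$ for each $i\le n$ (the dependence between the two families being arbitrary). *)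

(* Defs.v *)
From HB Require Import structures.
From mathcomp Require Import all_boot all_order all_algebra.
From mathcomp Require Import all_classical all_reals all_analysis.

Set Implicit Arguments.
Unset Strict Implicit.
Unset Printing Implicit Defensive.

Import Order.TTheory GRing.Theory Num.Theory.
Import numFieldNormedType.Exports.

Local Open Scope classical_set_scope.
Local Open Scope ring_scope.

Definition mutually_independent (d d' : measure_display)
    (T : measurableType d) (T' : measurableType d') (R : realType)
    (P : probability T R) (I : finType) (X : I -> {RV P >-> T'}) : Prop :=
  forall (J : {set I}) (A : I -> set T'), (forall i, measurable (A i)) ->
    P (\bigcap_(i in [set` J]) (X i @^-1` A i)) =
    (\prod_(i in J) P (X i @^-1` A i))%E.

(* [poisson_prob r k] ignores its second argument [k]; it is the Poisson law of
   mean [r] when [r > 0] and the Dirac mass at 0 when [r = 0]. *)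
Definition coupling (d : measure_display) (T : measurableType d) (R : realType)
    (P : probability T R) (n : nat) (p : 'I_n -> R)
    (nu : 'I_n -> {RV P >-> bool}) (xi : 'I_n -> {RV P >-> nat}) : Prop :=
  [/\ mutually_independent nu,
      mutually_independent xi,
      forall i, distribution P (nu i) = bernoulli_prob (p i) &
      forall i, distribution P (xi i) = poisson_prob (p i) 0].

(* Indices are 0-based: [partial_sum x k] is the sum of the first [k.+1] terms,
   so that [k : 'I_n] runs over the n nonempty partial sums. *)
Definition partial_sum (R : realType) (n : nat) (x : 'I_n -> R) (k : 'I_n) : R :=
  \sum_(i < n | (i <= k)%N) x i.

Definition max_deviation (T : Type) (R : realType) (n : nat)
    (nu : 'I_n -> T -> bool) (xi : 'I_n -> T -> nat) (w : T) : R :=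
  \big[Num.max/0]_(k < n)
    `|partial_sum (fun i => (nu i w)%:R - (xi i w)%:R) k|.

Definition minimal_distance (R : realType) (n : nat) (p : 'I_n -> R) (z : R) :
    \bar R :=
  ereal_inf [set x | exists (d : measure_display) (T : measurableType d)
    (P : probability T R)
    (nu : 'I_n -> {RV P >-> bool}) (xi : 'I_n -> {RV P >-> nat}),
    coupling p nu xi /\ x = P [set w | z < max_deviation R nu xi w]].

Definition B_coef (R : realType) (n : nat) (p : 'I_n -> R) (k : 'I_n) : R :=
  expR (- \sum_(i < n | (i <= k)%N) p i) * \prod_(j < n | (j < k)%N) p j.

(* Main.v *)
Require Import Defs.
From mathcomp Require Import all_boot all_order all_algebra.
From mathcomp Require Import all_classical all_reals all_analysis.
From mathcomp Require Import measurable_realfun ring lra.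

Import Order.TTheory GRing.Theory Num.Theory.
Import numFieldNormedType.Exports.

Local Open Scope classical_set_scope.
Local Open Scope ring_scope.

(** Both bounds only use the law of the Poisson family: events are exhibited that
force a large deviation whatever the Bernoulli variables do, so no coupling can
avoid them.

For the first bound, fix [z] and suppose that the Poisson process makes unit
steps before time [k] and then jumps by [z + 2]. Each earlier increment
[nu_i - 1] is nonpositive and the last one is at most [1 - (z + 2)], so the
difference of the partial sums at time [k] is at most [- (z + 1)]
([jump_max_deviation]). These events are disjoint for distinct [k], since
[z + 2] differs from 1, and by independence the [k]-th one has probability
[B_k p_k ^ (z + 2) / (z + 2)!] ([ones_then_jump_probability]). Summing over [k]
gives an explicit lower bound with [1 / (z + 2)!] in front, which the estimate
[m! <= m ^ (m + 1) e ^ (1 - m)] at [m = z + 2] turns into the stated constant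
([stirling_lower_factV]).

For the second bound, a Poisson variable equal to 2 or more cannot agree with a
Bernoulli one, and the first disagreement makes a partial sum nonzero
([max_deviation_gt0]). By independence the probability that no such value
occurs is [\prod_i (1 + p_i) e ^ (- p_i)], and each factor is at most
[exp (- p_i ^ 2 (1 - p_i) / 2)] ([one_add_mul_expRN_le]). *)

Set Implicit Arguments.
Unset Strict Implicit.

(** * Elementary inequalities *)

Lemma expR_ge_quadratic (R : realType) (x : R) : 0 <= x ->
  1 + x + x ^+ 2 / 2 <= expR x.
Proof.
move=> x0.
have -> : 1 + x + x ^+ 2 / 2 = series (exp_coeff x) 3.
  by rewrite /series/= !big_nat_recr//= big_nil /exp_coeff/= !expr1 expr0 add0r !divr1.
apply: nondecreasing_cvgn_le; last exact: is_cvg_series_exp_coeff.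
by apply: nondecreasing_series => i _ _; exact: exp_coeff_ge0.
Qed.

(** With [u = x - x^2 (1 - x) / 2 = x v] and [v = 1 - x / 2 + x^2 / 2], the
claim is [1 + x <= exp u]. The quadratic Taylor bound reduces it to
[x^2 (1 - x) <= u^2], that is, to [1 - x <= v^2], which follows from
[(1 - x / 2)^2 >= 1 - x]. The linear bound [1 + u <= exp u] would not suffice:
the two sides agree up to order 2 at 0. *)
Lemma one_add_mul_expRN_le (R : realType) (x : R) : 0 <= x <= 1 ->
  (1 + x) * expR (- x) <= expR (- (2^-1 * (x ^+ 2 * (1 - x)))).
Proof.
move=> /andP[x0 x1].
pose u := x - x ^+ 2 * (1 - x) / 2.
have u0 : 0 <= u by rewrite /u; nra.
have -> : - (2^-1 * (x ^+ 2 * (1 - x))) = u - x by rewrite /u; field.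
rewrite expRD ler_wpM2r ?expR_ge0//.
apply: le_trans (expR_ge_quadratic u0).
have : (1 - x / 2 + x ^+ 2 / 2) ^+ 2 >= 1 - x by nra.
have -> : u = x * (1 - x / 2 + x ^+ 2 / 2) by rewrite /u; field.
set v := (_ - _ + _); rewrite exprMn => hv.
have : 0 <= x ^+ 2 * (v ^+ 2 - (1 - x)) by rewrite mulr_ge0 ?sqr_ge0 ?subr_ge0.
by rewrite /v; lra.
Qed.

(** The weak Stirling estimate [m! <= m ^ (m + 1) e ^ (1 - m)], with [m + 1] in
place of [m]. The induction step is [e <= (1 + 1 / (m + 1)) ^ (m + 2)], i.e. the
[m + 2]-nd power of [1 - 1 / (m + 2) <= exp (- 1 / (m + 2))]. *)
Lemma factorial_le_exprn (R : realType) (m : nat) :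
  (m.+1)`!%:R <= m.+1%:R ^+ m.+2 * expR (- m%:R) :> R.
Proof.
elim: m => [|m IH]; first by rewrite oppr0 expR0 mulr1 expr1n.
rewrite factS natrM.
apply: le_trans (ler_wpM2l _ IH) _; first exact: ler0n.
rewrite [leRHS](_ : _ =
  m.+2%:R * (m.+2%:R ^+ m.+2 * expR (- 1) * expR (- m%:R))); last first.
  by rewrite -(mulrA _ (expR (- 1))) -expRD [_ ^+ m.+3]exprS -mulrA -addn1 natrD; do 3 f_equal; ring.
rewrite ler_wpM2l ?ler0n// ler_wpM2r ?expR_ge0//.
have h : m.+1%:R <= m.+2%:R * expR (- (m.+2%:R)^-1) :> R.
  rewrite -ler_pdivrMl ?ltr0Sn//.
  apply: le_trans (expR_ge1Dx _).
  rewrite [X in _ * X <= _](_ : _ = m.+2%:R - 1); last by rewrite -[in RHS]addn1 natrD addrK.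
  by rewrite mulrBr mulVf ?pnatr_eq0// mulr1.
have -> : expR (- 1) = expR (- (m.+2%:R)^-1) ^+ m.+2 :> R.
  by rewrite -expRM_natl mulrN divff ?pnatr_eq0.
by rewrite -exprMn; apply: lerXn2r => //; rewrite nnegrE ?mulr_ge0 ?ler0n ?expR_ge0.
Qed.

(** The left-hand side is [(2 pi)^(-1/2) e ^ z / (z + 2) ^ (z + 3)], and
[factorial_le_exprn] bounds [e ^ z / (z + 2) ^ (z + 3)] by [e ^ (- 1) / (z + 2)!];
the remaining factors are at most 1. *)
Lemma stirling_lower_factV (R : realType) (z : nat) :
  (Num.sqrt (2 * pi))^-1 * expR (- (z%:R + 3) * ln (z%:R + 2) + z%:R)
  <= ((z + 2)`!%:R)^-1 :> R.
Proof.
have pi2 : 1 <= Num.sqrt (2 * pi) :> R.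
  by rewrite -{1}(sqrtr1 R) ler_wsqrtr//; have := pi_ge2 R; lra.
have pos : 0 < z%:R + 2 :> R by rewrite ltr_wpDl.
apply: le_trans (_ : expR (- (z%:R + 3) * ln (z%:R + 2) + z%:R) <= _).
  by rewrite ler_piMl ?expR_ge0// invf_le1// (lt_le_trans _ pi2).
have -> : - (z%:R + 3) * ln (z%:R + 2) = - ((z + 3)%:R * ln (z%:R + 2)) :> R.
  by rewrite natrD mulNr.
rewrite expRD expRN expRM_natl lnK ?posrE//.
rewrite mulrC ler_pdivrMr ?exprn_gt0// mulrC ler_pdivlMr ?ltr0n ?fact_gt0//.
have /= := factorial_le_exprn R z.+1;
  rewrite -[z.+3]addn3 -[z.+2]addn2 [in X in _ <= X * _]natrD => h.
apply: le_trans (ler_wpM2l (expR_ge0 _) h) _.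
rewrite mulrCA ler_piMr ?exprn_ge0 ?(ltW pos)// -expRD expR_le1.
by rewrite -[z.+1]addn1 natrD; lra.
Qed.

(** * Poisson probabilities *)

Lemma poisson_prob_set1 (R : realType) (r : R) (k : nat) : 0 <= r ->
  poisson_prob r 0 [set k] = (expR (- r) * (r ^+ k / k`!%:R))%:E.
Proof.
rewrite /poisson_prob le_eqVlt => /predU1P[<-|r0].
  rewrite ltxx oppr0 expR0 mul1r expr0n diracE.
  case: k => [|k]; first by rewrite mem_set//= fact0 divr1.
  by rewrite memNset//= mul0r.
rewrite r0 esum_set1 ?lee_fin ?poisson_pmf_ge0//.
by rewrite /poisson_pmf r0 mulrC.
Qed.

Lemma poisson_prob_le1 (R : realType) (r : R) : 0 <= r ->
  poisson_prob r 0 [set k | (k <= 1)%N] = ((1 + r) * expR (- r))%:E.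
Proof.
move=> r0.
have -> : [set k | (k <= 1)%N] = [set 0%N] `|` [set 1%N].
  by apply/seteqP; split => -[|[|k]]//=; [left|right|case].
transitivity (poisson_prob r 0 [set 0%N] + poisson_prob r 0 [set 1%N])%E.
  by rewrite measureU//; apply/seteqP; split => k //= [->].
rewrite !poisson_prob_set1// -EFinD; congr (_%:E).
by rewrite expr0 expr1 fact0 divr1 (_ : 1`! = 1)%N// divr1; ring.
Qed.

Lemma joint_poisson_probability d (T : measurableType d) (R : realType)
    (P : probability T R) (n : nat) (p : 'I_n -> R)
    (xi : 'I_n -> {RV P >-> nat}) (J : {set 'I_n}) (A : 'I_n -> set nat) :
  mutually_independent xi ->
  (forall i, distribution P (xi i) = poisson_prob (p i) 0) ->
  P (\bigcap_(i in [set` J]) (xi i @^-1` A i)) =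
  (\prod_(i in J) poisson_prob (p i) 0 (A i))%E.
Proof.
move=> ind law; rewrite ind//; apply: eq_bigr => i _.
exact: (congr1 (fun m : set nat -> \bar R => m (A i)) (law i)).
Qed.

(** * Events forcing a deviation *)

Section Deviation.
Context {T : Type} {R : realType} {n : nat}.
Variables (nu : 'I_n -> T -> bool) (xi : 'I_n -> T -> nat) (w : T).

Let x (i : 'I_n) : R := (nu i w)%:R - (xi i w)%:R.

Lemma partial_sum_le_max_deviation (k : 'I_n) :
  `|partial_sum x k| <= max_deviation R nu xi w.
Proof. exact: (le_bigmax _ (fun k => `|partial_sum x k|)). Qed.

(** The values [nu i w <= 1 = xi i w] before [k] cannot compensate the jump, so the
sum at [k] is at most [1 - (z + 2)]. *)
Lemma jump_max_deviation (z : nat) (k : 'I_n) :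
    (forall i : 'I_n, (i < k)%N -> xi i w = 1%N) -> xi k w = (z + 2)%N ->
  z%:R < max_deviation R nu xi w.
Proof.
move=> x1 xk; apply: lt_le_trans (partial_sum_le_max_deviation k).
suff : partial_sum x k <= - (z%:R + 1).
  move=> h; rewrite ler0_norm; last by apply: le_trans h _; rewrite oppr_le0 ltW// ltr_wpDl.
  by rewrite ltrNr (le_lt_trans h)// ltrN2 ltrDl.
rewrite /partial_sum (bigD1 k)//= -[leRHS]addr0; apply: lerD.
  by rewrite /x xk natrD; case: (nu k w) => /=; lra.
apply: sumr_le0 => i /andP[ik nik]; rewrite /x x1; last by rewrite ltn_neqAle nik.
by case: (nu i w) => /=; lra.
Qed.

(** The increment at [j] is nonzero because [nu j w <= 1]. A later partial sum may
still vanish by cancellation; the one ending at the first nonzero increment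
cannot. *)
Lemma max_deviation_gt0 (j : 'I_n) : (2 <= xi j w)%N ->
  0 < max_deviation R nu xi w.
Proof.
move=> hj.
have xj : x j != 0.
  rewrite /x subr_eq0 eqr_nat; move: hj; case: (nu j w); case: (xi j w) => [|[|m]] //.
pose i := [arg min_(i < j | x i != 0%R) (i : nat)]%N.
have [xi0 mini] : x i != 0 /\ forall i', x i' != 0 -> (i <= i')%N.
  by rewrite /i; case: arg_minnP.
apply: lt_le_trans (partial_sum_le_max_deviation i).
rewrite normr_gt0 /partial_sum (bigD1 i)//= big1 ?addr0// => l /andP[li nli].
by apply/eqP; apply: contraNT nli => /mini il; apply/eqP/val_inj/anti_leq; rewrite li.
Qed.

End Deviation.

Lemma measurable_bigmaxr d (T : measurableType d) (R : realType) (D : set T)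
    (I : Type) (s : seq I) (h : I -> T -> R) (c : R) :
  (forall i, measurable_fun D (h i)) ->
  measurable_fun D (fun x => \big[Num.max/c]_(i <- s) h i x).
Proof.
move=> mh; elim: s => [|i s IH].
  by under eq_fun do rewrite big_nil; exact: measurable_cst.
under eq_fun do rewrite big_cons.
exact: measurable_maxr.
Qed.

Lemma measurable_max_deviation d (T : measurableType d) (R : realType)
    (P : probability T R) (n : nat) (nu : 'I_n -> {RV P >-> bool})
    (xi : 'I_n -> {RV P >-> nat}) :
  measurable_fun setT (max_deviation R nu xi).
Proof.
apply: measurable_bigmaxr => k.
apply: (measurableT_comp (@normr_measurable R setT)).
under eq_fun do rewrite /partial_sum -big_filter.
apply: measurable_sum => i.
apply: measurable_funB.
- by apply: (measurableT_comp (f := fun b : bool => (b%:R : R))).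
- by apply: (measurableT_comp (f := fun k : nat => (k%:R : R))).
Qed.

Lemma measurable_deviation_gt d (T : measurableType d) (R : realType)
    (P : probability T R) (n : nat) (nu : 'I_n -> {RV P >-> bool})
    (xi : 'I_n -> {RV P >-> nat}) (z : R) :
  measurable [set w | z < max_deviation R nu xi w].
Proof.
have := measurable_max_deviation nu xi measurableT
  (measurable_itv `]z, +oo[).
rewrite setTI; congr measurable.
by apply/seteqP; split => w /=; rewrite in_itv/= andbT.
Qed.

(** * Unit steps followed by a jump *)

Definition ones_then_jump {T : Type} {n : nat} (xi : 'I_n -> T -> nat) (z : nat)
    (k : 'I_n) : set T :=
  \bigcap_(i in [set` [set i : 'I_n | (i <= k)%N]%SET])
    (xi i @^-1` [set if (i < k)%N then 1%N else (z + 2)%N]).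

Lemma ones_then_jumpP {T : Type} {n : nat} (xi : 'I_n -> T -> nat) (z : nat)
    (k : 'I_n) (w : T) : ones_then_jump xi z k w ->
  (forall i : 'I_n, (i < k)%N -> xi i w = 1%N) /\ xi k w = (z + 2)%N.
Proof.
move=> h; split=> [i ik|]; last by rewrite (h k) ?ltnn//= inE.
by rewrite (h i) ?ik//= inE ltnW.
Qed.

Lemma trivIset_ones_then_jump {T : Type} {n : nat} (xi : 'I_n -> T -> nat) (z : nat) :
  trivIset setT (ones_then_jump xi z).
Proof.
move=> i j _ _ [w [hi hj]].
have [i1 i2] := ones_then_jumpP hi; have [j1 j2] := ones_then_jumpP hj.
apply/val_inj; case: (ltngtP i j) => // [/j1|/i1]; first by rewrite i2 addn2.
by rewrite j2 addn2.
Qed.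

Lemma measurable_ones_then_jump d (T : measurableType d) (R : realType)
    (P : probability T R) (n : nat) (xi : 'I_n -> {RV P >-> nat}) (z : nat)
    (k : 'I_n) : measurable (ones_then_jump xi z k).
Proof.
apply: fin_bigcap_measurable; first exact: finite_finset.
by move=> i _; rewrite -[X in measurable X]setTI; exact: measurable_funP.
Qed.

(** The Poisson weights are [e ^ (- p_i) p_i] for [i < k] and
[e ^ (- p_k) p_k ^ (z + 2) / (z + 2)!] at [k]; the exponentials and the factors
[p_i] with [i < k] make up [B_k]. *)
Lemma ones_then_jump_probability d (T : measurableType d) (R : realType)
    (P : probability T R) (n : nat) (p : 'I_n -> R)
    (xi : 'I_n -> {RV P >-> nat}) (z : nat) (k : 'I_n) :
  (forall i, 0 <= p i) -> mutually_independent xi ->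
  (forall i, distribution P (xi i) = poisson_prob (p i) 0) ->
  P (ones_then_jump xi z k) = (B_coef p k * p k ^+ (z + 2) / (z + 2)`!%:R)%:E.
Proof.
move=> p0 ind law; rewrite (joint_poisson_probability (p := p))//.
under eq_bigr do rewrite poisson_prob_set1//.
rewrite prodEFin; congr _%:E.
under eq_bigl do rewrite inE.
rewrite big_split/= -expR_sum sumrN -!mulrA; congr (_ * _).
rewrite (bigD1 k)//= ltnn mulrC; congr (_ * _).
apply: eq_big => [i|i /andP[ik nik]]; first by rewrite ltn_neqAle andbC.
by rewrite ltn_neqAle nik ik expr1 (_ : 1`! = 1)%N// divr1.
Qed.

(** * Lower bounds for every coupling *)

Lemma max_deviation_gt_ge d (T : measurableType d) (R : realType)
    (P : probability T R) (n : nat) (p : 'I_n -> R)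
    (nu : 'I_n -> {RV P >-> bool}) (xi : 'I_n -> {RV P >-> nat}) (z : nat) :
  (forall i, 0 <= p i) -> coupling p nu xi ->
  ((\sum_(k < n) B_coef p k * p k ^+ (z + 2) / (z + 2)`!%:R)%:E
   <= P [set w | (z%:R < max_deviation R nu xi w)%R])%E.
Proof.
move=> p0 [_ ind _ law].
rewrite -sumEFin (eq_bigr (fun k => P (ones_then_jump xi z k))); last first.
  by move=> k _; rewrite (ones_then_jump_probability z k p0 ind law).
have mJ k : measurable (ones_then_jump xi z k) by exact: measurable_ones_then_jump.
rewrite -(measure_bigsetU_ord P xpredT mJ); last exact: trivIset_ones_then_jump.
apply: le_measure; rewrite ?inE.
- exact: bigsetU_measurable.
- exact: measurable_deviation_gt.
- elim/big_ind: _ => [|A B hA hB|k _]; [by []|by rewrite subUset|].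
  by move=> w hw; have [x1 xk] := ones_then_jumpP hw; exact: jump_max_deviation x1 xk.
Qed.

Lemma max_deviation_gt0_ge d (T : measurableType d) (R : realType)
    (P : probability T R) (n : nat) (p : 'I_n -> R)
    (nu : 'I_n -> {RV P >-> bool}) (xi : 'I_n -> {RV P >-> nat}) :
  (forall i, 0 <= p i <= 1) -> coupling p nu xi ->
  ((1 - expR (- (2^-1 * \sum_(i < n) p i ^+ 2 * (1 - p i))))%:E
   <= P [set w | (0 < max_deviation R nu xi w)%R])%E.
Proof.
move=> p01 [_ ind _ law].
pose E := \bigcap_(i in [set` [set: 'I_n]%SET]) (xi i @^-1` [set k | (k <= 1)%N]).
have mE : measurable E.
  apply: fin_bigcap_measurable; first exact: finite_finset.
  by move=> i _; rewrite -[X in measurable X]setTI; exact: measurable_funP.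
apply: (@le_trans _ _ (P (~` E))); last first.
  apply: le_measure; rewrite ?inE; [exact: measurableC|exact: measurable_deviation_gt|].
  move=> w /= /existsNP[j] /not_implyP[_ /negP]; rewrite -ltnNge.
  exact: max_deviation_gt0.
rewrite probability_setC// EFinB leeB//.
rewrite (joint_poisson_probability (p := p))//.
under eq_bigr => i _ do rewrite poisson_prob_le1 ?(andP (p01 i)).1//.
rewrite prodEFin lee_fin mulr_sumr -sumrN expR_sum.
under eq_bigl do rewrite inE.
apply: ler_prod => i _; rewrite one_add_mul_expRN_le// andbT.
by have /andP[? _] := p01 i; rewrite mulr_ge0 ?expR_ge0// ler_wpDl.
Qed.

Theorem theorem3 (R : realType) (n : nat) (p : 'I_n -> R)
    (hn : (1 <= n)%N) (hp : forall i, 0 <= p i <= 1) :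
  (forall z : nat,
    (((Num.sqrt (2 * pi))^-1 *
      expR (- (z%:R + 3) * ln (z%:R + 2) + z%:R) *
      \sum_(k < n) B_coef p k * p k ^+ (z + 2))%:E
     <= minimal_distance p z%:R)%E) /\
  ((1 - expR (- (2^-1 * \sum_(i < n) p i ^+ 2 * (1 - p i))))%:E
   <= minimal_distance p 0)%E.
Proof.
have p0 i : 0 <= p i by have /andP[] := hp i.
split=> [z|]; apply: le_ereal_inf_tmp => _ [d [T [P [nu [xi [cpl ->]]]]]].
  apply: le_trans (max_deviation_gt_ge z p0 cpl).
  rewrite -mulr_suml lee_fin mulrC ler_wpM2l ?stirling_lower_factV//.
  apply: sumr_ge0 => k _; rewrite mulr_ge0 ?exprn_ge0//.
  by rewrite mulr_ge0 ?expR_ge0// prodr_ge0.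
exact: max_deviation_gt0_ge.
Qed.
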